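(* Let $\mathcal{X}\in\mathbb{R}^{I_1\times I_2\times\cdots\times I_N}$ be an $N$-order real tensor, let $n\in\{1,\dots,N\}$, let $U\in\mathbb{R}^{J_n\times I_n}$ be a matrix, and let $\sigma\in S_N$ be a non-identity permutation. Then $$\mathcal{X}^{T\sigma}\times_{\sigma^{-1}(n)}U=(\mathcal{X}\times_n U)^{T\sigma}.$$
   Context: An $N$-order real tensor of size $I_1\times\cdots\times I_N$ is an array $\mathcal{X}$ with real entries $\mathcal{X}(i_1,\dots,i_N)$, $1\le i_k\le I_k$. Tensor transpose: for a non-identity permutation $\sigma\in S_N$ and an $N$-order tensor $\mathcal{X}$ of size $I_1\times\cdots\times I_N$, the transpose $\mathcal{X}^{T\sigma}$ is the tensor of size $I_{\sigma(1)}\times\cdots\times I_{\sigma(N)}$ with entries $\mathcal{X}^{T\sigma}(i_{\sigma(1)},i_{\sigma(2)},\dots,i_{\sigma(N)})=\mathcal{X}(i_1,i_2,\dots,i_N)$ for all indices $1\le i_k\le I_k$. $n$-mode product: for $\mathcal{X}$ of size $I_1\times\cdots\times I_N$ and a matrix $U$ of size $J_n\times I_n$, $\mathcal{X}\times_n U$ is the tensor of size $I_1\times\cdots\times I_{n-1}\times J_n\times I_{n+1}\times\cdots\times I_N$ with entries $$(\mathcal{X}\times_n U)(i_1,\dots,i_{n-1},j_n,i_{n+1},\dots,i_N)=\sum_{i_n=1}^{I_n}\mathcal{X}(i_1,\dots,i_N)\,U(j_n,i_n).$$ *)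

(* Defs.v *)
From HB Require Import structures.
From mathcomp Require Import all_boot all_order all_algebra all_fingroup.
From mathcomp Require Import reals.

Set Implicit Arguments.
Unset Strict Implicit.
Unset Printing Implicit Defensive.

Import GRing.Theory.
Local Open Scope ring_scope.

(* Modes are numbered from 0: mode k : 'I_N has dimension d k, and the k-th
   component of a multi-index ranges over 'I_(d k). *)
Notation multi_index d := {dffun forall k, 'I_(d k)}.

Definition tensor (R : Type) (N : nat) (d : 'I_N -> nat) : Type :=
  {ffun multi_index d -> R}.

(* Equality of tensors whose sizes agree only propositionally is stated through
   these casts; cast_ord leaves the underlying natural numbers unchanged. *)
Definition index_cast (N : nat) (d d' : 'I_N -> nat) (e : d =1 d')
    (i : multi_index d) : multi_index d' :=
  [ffun k : 'I_N => cast_ord (e k) (i k) : 'I_(d' k)].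

Definition tensor_cast (R : Type) (N : nat) (d d' : 'I_N -> nat) (e : d =1 d')
    (X : tensor R d) : tensor R d' :=
  [ffun i : multi_index d' => X (index_cast (fsym e) i)].

Definition perm_dims (N : nat) (s : 'S_N) (d : 'I_N -> nat) : 'I_N -> nat :=
  fun k => d (s k).

Definition perm_index (N : nat) (s : 'S_N) (d : 'I_N -> nat) (i : multi_index d) :
    multi_index (perm_dims s d) :=
  [ffun k : 'I_N => i (s k) : 'I_(perm_dims s d k)].

Lemma perm_dimsKV (N : nat) (s : 'S_N) (d : 'I_N -> nat) (m : 'I_N) :
  perm_dims s d ((s^-1)%g m) = d m.
Proof. by rewrite /perm_dims permKV. Qed.

(* The inverse of perm_index: it recovers (i_1, ..., i_N) from
   (i_{s 1}, ..., i_{s N}). *)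
Definition unperm_index (N : nat) (s : 'S_N) (d : 'I_N -> nat)
    (j : multi_index (perm_dims s d)) : multi_index d :=
  [ffun m : 'I_N => cast_ord (perm_dimsKV s d m) (j ((s^-1)%g m)) : 'I_(d m)].

Definition transpose (R : Type) (N : nat) (d : 'I_N -> nat) (s : 'S_N)
    (X : tensor R d) : tensor R (perm_dims s d) :=
  [ffun j : multi_index (perm_dims s d) => X (unperm_index j)].

Lemma perm_indexK (N : nat) (s : 'S_N) (d : 'I_N -> nat) :
  cancel (@perm_index N s d) (@unperm_index N s d).
Proof.
move=> i; apply/ffunP => m; rewrite !ffunE; apply: val_inj => /=.
suff e k k' : k = k' -> i k = i k' :> nat by apply: e; rewrite permKV.
by move=> ->.
Qed.

Lemma transposeE (R : Type) (N : nat) (d : 'I_N -> nat) (s : 'S_N)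
    (X : tensor R d) (i : multi_index d) :
  transpose s X (perm_index s i) = X i.
Proof. by rewrite ffunE perm_indexK. Qed.

Definition set_dim (N : nat) (d : 'I_N -> nat) (n : 'I_N) (J : nat) :
    'I_N -> nat :=
  fun k => if k == n then J else d k.

Lemma set_dim_eq (N : nat) (d : 'I_N -> nat) (n : 'I_N) (J : nat) (k : 'I_N) :
  k = n -> set_dim d n J k = J.
Proof. by move=> ->; rewrite /set_dim eqxx. Qed.

Lemma set_dim_neq (N : nat) (d : 'I_N -> nat) (n : 'I_N) (J : nat) (k : 'I_N) :
  k <> n -> set_dim d n J k = d k.
Proof. by move=> /eqP/negPf kn; rewrite /set_dim kn. Qed.

(* From (i_1, ..., j_n, ..., i_N) and i_n, the multi-index
   (i_1, ..., i_n, ..., i_N). *)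
Definition restore_index (N : nat) (d : 'I_N -> nat) (n : 'I_N) (J : nat)
    (j : multi_index (set_dim d n J)) (a : 'I_(d n)) : multi_index d :=
  [ffun k : 'I_N =>
     match k =P n with
     | ReflectT kn => cast_ord (congr1 d (esym kn)) a
     | ReflectF kn => cast_ord (set_dim_neq d J kn) (j k)
     end : 'I_(d k)].

Definition mode_prod (R : pzRingType) (N : nat) (d : 'I_N -> nat)
    (X : tensor R d) (n : 'I_N) (J : nat) (U : 'M[R]_(J, d n)) :
    tensor R (set_dim d n J) :=
  [ffun j : multi_index (set_dim d n J) =>
     \sum_(a < d n) X (restore_index j a) *
                    U (cast_ord (set_dim_eq d J (erefl n)) (j n)) a].

Lemma set_perm_dims (N : nat) (s : 'S_N) (d : 'I_N -> nat) (n : 'I_N)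
    (J : nat) :
  set_dim (perm_dims s d) ((s^-1)%g n) J =1 perm_dims s (set_dim d n J).
Proof.
by move=> k; rewrite /set_dim /perm_dims -(inj_eq (@perm_inj _ s)) permKV.
Qed.

(* Main.v *)
Require Import Defs.
From mathcomp Require Import all_boot all_order all_algebra all_fingroup.
From mathcomp Require Import reals.

Set Implicit Arguments.
Unset Strict Implicit.
Unset Printing Implicit Defensive.

Local Open Scope ring_scope.

(** Entrywise, both sides are the same sum over the contracted index: mode [n] of [X] sits at
    position [s^-1 n] of the transpose, so filling that position and undoing the permutation is
    undoing it and filling mode [n] ([unperm_restore_index]). Dimension casts preserve
    natural-number values, so indices are compared in [nat]. *)

Lemma index_castE (N : nat) (d d' : 'I_N -> nat) (e : d =1 d')
    (i : multi_index d) (k : 'I_N) :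
  index_cast e i k = i k :> nat.
Proof. by rewrite ffunE. Qed.

Lemma unperm_indexE (N : nat) (s : 'S_N) (d : 'I_N -> nat)
    (j : multi_index (perm_dims s d)) (m : 'I_N) :
  unperm_index j m = j ((s^-1)%g m) :> nat.
Proof. by rewrite ffunE. Qed.

Lemma restore_indexE (N : nat) (d : 'I_N -> nat) (n : 'I_N) (J : nat)
    (j : multi_index (set_dim d n J)) (a : 'I_(d n)) (k : 'I_N) :
  restore_index j a k = (if k == n then a : nat else j k) :> nat.
Proof. by rewrite ffunE; case: (k =P n). Qed.

(** Both sides put [a] in mode [n] and read [j] at [s^-1 m] in every other mode [m]. *)
Lemma unperm_restore_index (N : nat) (s : 'S_N) (d : 'I_N -> nat) (n : 'I_N)
    (J : nat) (j : multi_index (perm_dims s (set_dim d n J))) (a : 'I_(d n)) :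
  unperm_index (restore_index (index_cast (fsym (set_perm_dims s d n J)) j)
                  (cast_ord (esym (perm_dimsKV s d n)) a)) =
  restore_index (unperm_index j) a.
Proof.
apply/ffunP => m; apply: val_inj => /=.
(* Injectivity of [s^-1] turns the left-hand test for the filled position into [m == n]. *)
rewrite unperm_indexE !restore_indexE (inj_eq perm_inj).
by case: eqP => // _; rewrite index_castE unperm_indexE.
Qed.

Theorem proposition3p1 (R : realType) (N : nat) (I : 'I_N -> nat)
    (X : tensor R I) (n : 'I_N) (J : nat) (U : 'M[R]_(J, I n))
    (s : 'S_N) (hs : s != 1%g) :
  tensor_cast (set_perm_dims s I n J)
    (mode_prod (transpose s X) (n := (s^-1)%g n)
       (castmx (erefl J, esym (perm_dimsKV s I n)) U)) =
  transpose s (mode_prod X U).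
Proof.
apply/ffunP => j; rewrite [LHS]ffunE [LHS]ffunE [RHS]ffunE [RHS]ffunE.
(* The left sum runs over mode [s^-1 n] of the permuted dimensions, whose size equals [I n] only
   propositionally. *)
rewrite (reindex (cast_ord (esym (perm_dimsKV s I n)))) /=; last first.
  by apply: onW_bij; exact: Bijective (cast_ordK _) (cast_ordKV _).
apply: eq_bigr => a _; rewrite [transpose _ _ _]ffunE unperm_restore_index.
congr (_ * _); rewrite castmxE /=.
(* The column casts cancel; both row indices have the value of [j] at [s^-1 n]. *)
congr (U _ _); apply: val_inj => //=.
by rewrite index_castE unperm_indexE.
Qed.
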